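(* Let $X$ be a set, let $(R_x)_{x\in X}$ be a family of local rings, with $\mathfrak{m}_x$ the maximal ideal of $R_x$, and let $\Gamma=\prod_{x\in X}R_x$. For a maximal ideal $M$ of $\mathcal{P}(X)$ let $M^{\flat}=\{f\in\Gamma:\Omega(f)\in M\}$, where $\Omega(f)=\{x\in X: f_x\notin\mathfrak{m}_x\}$ for $f=(f_x)\in\Gamma$. Then the map $\psi:\operatorname{Spec}\mathcal{P}(X)\to\operatorname{Max}(\Gamma)$ given by $M\mapsto M^{\flat}$ is a homeomorphism.
   Context: All rings are commutative with $1$; a local ring is a ring with exactly one maximal ideal (no Noetherian hypothesis). $\mathcal{P}(X)$ denotes the power set ring of $X$: the set of all subsets of $X$ with addition $A+B=(A\cup B)\setminus(A\cap B)$ and multiplication $A\cdot B=A\cap B$; all its prime ideals are maximal. $\operatorname{Spec}$ carries the Zariski topology, and $\operatorname{Max}(\Gamma)$, the set of maximal ideals of $\Gamma$, carries the topology induced from the Zariski topology of $\operatorname{Spec}(\Gamma)$. *)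

(* Defs.v *)
From HB Require Import structures.
From mathcomp Require Import all_boot all_order all_algebra.
From mathcomp Require Import all_classical.
From mathcomp Require Import topology.

Set Implicit Arguments.
Unset Strict Implicit.
Unset Printing Implicit Defensive.

Import GRing.Theory.
Local Open Scope classical_set_scope.
Local Open Scope ring_scope.

(* The ideals of [ring_quotient] require a nonzero ring, whereas the power set
   ring of the empty set and the empty product of rings are zero rings. *)
Section Ideals.
Variable R : comPzRingType.
Implicit Types I J : set R.

Definition ideal I :=
  [/\ I 0, forall a b, I a -> I b -> I (a + b) & forall r a, I a -> I (r * a)].

Definition prime_ideal I :=
  [/\ ideal I, I <> setT & forall a b, I (a * b) -> I a \/ I b].

Definition maximal_ideal I :=
  [/\ ideal I, I <> setT &
      forall J, ideal J -> I `<=` J -> J = I \/ J = setT].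

Definition local_ring := exists! I, maximal_ideal I.

Record Spec := MkSpec { Spec_set :> set R ; Spec_prime : prime_ideal Spec_set }.

End Ideals.

HB.instance Definition _ (R : comPzRingType) := gen_eqMixin (Spec R).
HB.instance Definition _ (R : comPzRingType) := gen_choiceMixin (Spec R).

Section Zariski.
Variable R : comPzRingType.

Definition zero_locus (E : set R) : set (Spec R) :=
  [set p : Spec R | E `<=` Spec_set p].

Definition zariski_open : set_system (Spec R) :=
  [set U | exists E, U = ~` zero_locus E].

Let zariski_openT : zariski_open setT.
Proof.
exists setT; apply/seteqP; split=> // p _ /= pT.
by case: (Spec_prime p) => _ + _; apply; apply/seteqP; split.
Qed.

Let zariski_openI : setI_closed zariski_open.
Proof.
move=> _ _ [E ->] [F ->]; exists [set a * b | a in E & b in F].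
rewrite -setCU; congr (~` _); apply/seteqP; split=> p /=.
  case: (Spec_prime p) => -[_ _ pM] _ _ [pE|pF] _ [a Ea [b Fb <-]].
    by rewrite mulrC; apply: pM; exact: pE.
  by apply: pM; exact: pF.
move=> pEF; have [pE|/existsNP[a /not_implyP[Ea npa]]] := pselect (E `<=` p).
  by left.
right=> b Fb; case: (Spec_prime p) => _ _ /(_ a b); case=> //.
by apply: pEF; exists a => //; exists b.
Qed.

Let zariski_open_bigU (I : Type) (f : I -> set (Spec R)) :
  (forall i, zariski_open (f i)) -> zariski_open (\bigcup_i f i).
Proof.
move=> /choice[E fE]; exists (\bigcup_i E i).
apply/seteqP; split=> p /=.
  by move=> [i _]; rewrite fE => npE pE; apply: npE => a Ea; apply: pE; exists i.
move=> /existsNP[a /not_implyP[[i _ Ea] npa]]; exists i => //.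
by rewrite fE => /(_ a Ea).
Qed.

HB.instance Definition _ := isOpenTopological.Build (Spec R)
  zariski_openT zariski_openI zariski_open_bigU.

(* As a type, [Max R] is the sigma type of this subset of [Spec R], which the
   library endows with the induced topology. *)
Definition Max : set (Spec R) := [set p | maximal_ideal (Spec_set p)].

End Zariski.

Arguments Max R : clear implicits.

Definition homeomorphism (T U : topologicalType) (f : T -> U) :=
  exists g : U -> T, [/\ cancel f g, cancel g f, continuous f & continuous g].

Definition powerset_ring (X : Type) : Type := set X.

Section PowersetRing.
Variable X : Type.

HB.instance Definition _ := Choice.copy (powerset_ring X) (set X).

HB.instance Definition _ := @GRing.isZmodule.Build (powerset_ring X)
  set0 id (@setY X) (@setYA X) (@setYC X) (@set0Y X) (@setYK X).

HB.instance Definition _ := @GRing.Zmodule_isComPzRing.Build (powerset_ring X)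
  setT (@setI X) (@setIA X) (@setIC X) (@setTI X) (@setIYl X).

End PowersetRing.

(* The library only has the ring structure on non-dependent function types. *)
Definition prod_ring (X : Type) (R : X -> comPzRingType) : Type :=
  forall x, R x.

Section ProdRing.
Variables (X : Type) (R : X -> comPzRingType).
Implicit Types f g h : prod_ring R.

HB.instance Definition _ := Choice.copy (prod_ring R) (forall x, R x).

Definition prod_zero : prod_ring R := fun=> 0.
Definition prod_opp f : prod_ring R := fun x => - f x.
Definition prod_add f g : prod_ring R := fun x => f x + g x.
Definition prod_one : prod_ring R := fun=> 1.
Definition prod_mul f g : prod_ring R := fun x => f x * g x.

Let prod_addA : associative prod_add.
Proof. by move=> f g h; apply/functional_extensionality_dep => x; exact: addrA. Qed.

Let prod_addC : commutative prod_add.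
Proof. by move=> f g; apply/functional_extensionality_dep => x; exact: addrC. Qed.

Let prod_add0 : left_id prod_zero prod_add.
Proof. by move=> f; apply/functional_extensionality_dep => x; exact: add0r. Qed.

Let prod_addN : left_inverse prod_zero prod_opp prod_add.
Proof. by move=> f; apply/functional_extensionality_dep => x; exact: addNr. Qed.

HB.instance Definition _ := @GRing.isZmodule.Build (prod_ring R)
  prod_zero prod_opp prod_add prod_addA prod_addC prod_add0 prod_addN.

Let prod_mulA : associative prod_mul.
Proof. by move=> f g h; apply/functional_extensionality_dep => x; exact: mulrA. Qed.

Let prod_mulC : commutative prod_mul.
Proof. by move=> f g; apply/functional_extensionality_dep => x; exact: mulrC. Qed.

Let prod_mul1 : left_id prod_one prod_mul.
Proof. by move=> f; apply/functional_extensionality_dep => x; exact: mul1r. Qed.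

Let prod_mulDl : left_distributive prod_mul prod_add.
Proof. by move=> f g h; apply/functional_extensionality_dep => x; exact: mulrDl. Qed.

HB.instance Definition _ := @GRing.Zmodule_isComPzRing.Build (prod_ring R)
  prod_one prod_mul prod_mulA prod_mulC prod_mul1 prod_mulDl.

Variable m : forall x, set (R x).

Definition Omega f : powerset_ring X := [set x | ~ @m x (f x)].

Definition flat (M : set (powerset_ring X)) : set (prod_ring R) :=
  [set f | M (Omega f)].

End ProdRing.

(* Main.v *)
Require Import Defs.
From HB Require Import structures.
From mathcomp Require Import all_boot all_order all_algebra.
From mathcomp Require Import all_classical.
From mathcomp Require Import topology.
From mathcomp Require Import ring.

(** Two maps relate the ideals of the power set ring and those of the product:
    an element [f] of the product has a support modulo the maximal ideals,
    [Omega m f], and a subset [A] of [X] has an indicator [indic R A], an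
    idempotent of the product with [Omega m (indic R A) = A].

    Since an element of a local ring outside the maximal ideal is a unit, [f]
    can be inverted on [Omega m f], so that some multiple of [f] is the
    indicator of [Omega m f] ([indic_Omega_multiple]).  This carries the whole
    proof.  Firstly, if [M] is prime and [f] is not in [flat m M], then the
    complement of [Omega m f] is in [M], and its indicator is of the form
    [1 - g * f]: thus [f] is invertible modulo [flat m M], which is therefore
    maximal ([flat_maximal]).  Secondly, the inverse map sends a prime [N] of
    the product to the set of those [A] whose indicator is in [N]
    ([indic_ideal]).  If [f] is in [N], so is the indicator of [Omega m f];
    hence [N] is contained in the proper ideal [flat m (indic_ideal N)], and
    when [N] is maximal the two are equal ([indic_idealK]).

    Both maps are continuous because the preimage of the zero locus of [E] is
    the zero locus of the image of [E], under [Omega m] for one map and under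
    [indic R] for the other. *)

Set Implicit Arguments.
Unset Strict Implicit.
Unset Printing Implicit Defensive.

Import GRing.Theory.
Local Open Scope classical_set_scope.
Local Open Scope ring_scope.

(** * Ideals of commutative rings *)

Section IdealTheory.
Variable R : comPzRingType.
Implicit Types I J M N : set R.

Lemma ideal1_setT I : ideal I -> I 1 -> I = setT.
Proof.
by case=> _ _ IM I1; apply/seteqP; split=> // a _; rewrite -[a]mulr1; exact: IM.
Qed.

Lemma ideal_proper I : ideal I -> I <> setT <-> ~ I 1.
Proof.
move=> idI; split=> [IT /(ideal1_setT idI)//|I1 IT].
by apply: I1; rewrite IT.
Qed.

Definition adjoin I (a : R) : set R := [set y | exists r, I (y - r * a)].

Lemma ideal_adjoin I a : ideal I -> ideal (adjoin I a).
Proof.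
move=> [I0 ID IM]; split.
- by exists 0; rewrite mul0r subr0.
- move=> y z [r Iy] [s Iz]; exists (r + s).
  have -> : y + z - (r + s) * a = (y - r * a) + (z - s * a) by ring.
  exact: ID.
- move=> t y [r Iy]; exists (t * r).
  have -> : t * y - t * r * a = t * (y - r * a) by ring.
  exact: IM.
Qed.

Lemma sub_adjoin I a : I `<=` adjoin I a.
Proof. by move=> y Iy; exists 0; rewrite mul0r subr0. Qed.

(** The quotient by an ideal is a field exactly when the ideal is maximal; the
    right-hand side says so by inverting elements modulo [I]. *)
Lemma maximal_idealP I :
  maximal_ideal I <->
  [/\ ideal I, ~ I 1 & forall a, ~ I a -> exists r, I (1 - r * a)].
Proof.
split=> [[idI /(ideal_proper idI) I1 maxI]|[idI I1 invI]].
  split=> // a nIa.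
  have [eqI|eqT] := maxI _ (ideal_adjoin a idI) (@sub_adjoin I a).
    case: nIa; rewrite -eqI; exists 1.
    by rewrite mul1r subrr; case: idI.
  by have : adjoin I a 1 by rewrite eqT.
split=> //; first exact/ideal_proper.
move=> J idJ IJ.
have [JI|/existsNP[a /not_implyP[Ja nIa]]] := pselect (J `<=` I).
  by left; apply/seteqP.
right; apply: ideal1_setT => //; have [r Ira] := invI a nIa.
have [_ JD JM] := idJ; rewrite -(subrK (r * a) 1).
by apply: JD; [exact: IJ | exact: JM].
Qed.

Lemma maximal_prime I : maximal_ideal I -> prime_ideal I.
Proof.
move=> maxI; have [idI properI _] := maxI; have [_ ID IM] := idI.
split=> // a b Iab; have [|nIa] := pselect (I a); first by left.
right; have /maximal_idealP[_ _ /(_ a nIa)[r Ira]] := maxI.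
have -> : b = b * (1 - r * a) + r * (a * b) by ring.
by apply: ID; exact: IM.
Qed.

Lemma maximal_ideal_eq I J :
  maximal_ideal I -> ideal J -> ~ J 1 -> I `<=` J -> J = I.
Proof.
move=> [_ _ maxI] idJ J1 IJ; case: (maxI J idJ IJ) => // JT.
by case: J1; rewrite JT.
Qed.

Lemma exists_maximal_ideal I : ideal I -> ~ I 1 ->
  exists2 N, maximal_ideal N & I `<=` N.
Proof.
move=> idI I1.
(* The empty chain has an empty union, which is not an ideal.  Zorn's lemma
     is therefore applied to the sets [J] such that [I `|` J] is a proper
     ideal, which include the empty set. *)
  pose P J := ideal (I `|` J) /\ ~ (I `|` J) 1.
have chain F : F `<=` P -> total_on F subset -> P (\bigcup_(J in F) J).
  move=> FP Ftot; split; last first.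
    by move=> [//|[J FJ J1]]; case: (FP J FJ) => _; apply; right.
  have sub J : F J -> I `|` J `<=` I `|` \bigcup_(J in F) J.
    by move=> FJ; apply: setUS => y Jy; exists J.
  have [I0 ID IM] := idI.
  split; first by left.
  - move=> a b [Ia|[J FJ Ja]] [Ib|[K FK Kb]].
    + by left; exact: ID.
    + apply: (sub K FK); case: (FP K FK) => -[_ KD _] _.
      by apply: KD; [left | right].
    + apply: (sub J FJ); case: (FP J FJ) => -[_ JD _] _.
      by apply: JD; [right | left].
    + case: (Ftot J K FJ FK) => [JK|KJ].
        apply: (sub K FK); case: (FP K FK) => -[_ KD _] _.
        by apply: KD; right => //; exact: JK.
      apply: (sub J FJ); case: (FP J FJ) => -[_ JD _] _.
      by apply: JD; right => //; exact: KJ.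
  - move=> r a [Ia|[J FJ Ja]]; first by left; exact: IM.
    apply: (sub J FJ); case: (FP J FJ) => -[_ _ JM] _.
    by apply: JM; right.
have [A [[idA A1] maxA]] := Zorn_bigcup chain.
exists (I `|` A); last exact: subsetUl.
split=> //; first exact/ideal_proper.
move=> J idJ AJ; have [JT|properJ] := pselect (J = setT); first by right.
left; apply: contrapT => JA; apply: (maxA J).
  split; first exact: subset_trans AJ.
  by move=> JsubA; apply: JA; apply/seteqP; split=> // y /JsubA; right.
have IJ : I `|` J = J by apply/setUidPr; exact: subset_trans AJ.
by rewrite /P IJ; split=> //; exact/ideal_proper.
Qed.

(** A nonunit generates a proper ideal, hence lies in some maximal ideal, and
    the only one is [M]. *)
Lemma local_unit M a : local_ring R -> maximal_ideal M -> ~ M a ->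
  exists r, r * a = 1.
Proof.
move=> [L [_ uniqL]] maxM nMa; apply: contrapT => noinv.
have id0 : ideal [set 0 : R].
  by split=> // [_ _ -> ->|r _ ->]; rewrite /= ?addr0 ?mulr0.
(* [adjoin [set 0] a] is the principal ideal generated by [a]. *)
have [|N maxN aN] := exists_maximal_ideal (ideal_adjoin a id0).
  by move=> [r /= /subr0_eq ra1]; apply: noinv; exists r.
apply: nMa; rewrite -(uniqL M maxM) (uniqL N maxN).
by apply: aN; exists 1; rewrite /= mul1r subrr.
Qed.

Lemma Spec_inj (p q : Spec R) : Spec_set p = Spec_set q -> p = q.
Proof.
case: p q => [I primeI] [J primeJ] /= eqIJ; subst J.
by congr MkSpec; exact: Prop_irrelevance.
Qed.

End IdealTheory.

(** The preimage of the zero locus of [E] is the zero locus of [phi @` E].  The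
    map [phi] is one of underlying sets because this is applied to [Omega m]
    and [indic R], neither of which preserves addition in general. *)
Lemma continuous_preimage (A B : comPzRingType) (phi : A -> B)
    (F : Spec B -> Spec A) :
  (forall p a, Spec_set (F p) a <-> Spec_set p (phi a)) -> continuous F.
Proof.
move=> Fphi; apply/continuousP => _ [E ->]; exists (phi @` E).
rewrite preimage_setC; congr (~` _); apply/seteqP; split=> p /= pE.
  by move=> _ [a Ea <-]; apply/Fphi; exact: pE.
by move=> a Ea; apply/Fphi; apply: pE; exists a.
Qed.

(** * Prime ideals of the power set ring *)

Section PowersetIdeals.
Variable X : Type.
Implicit Types (M : set (powerset_ring X)) (A B : powerset_ring X).

Lemma powerset_ideal_sub M A B : ideal M -> (A : set X) `<=` B -> M B -> M A.
Proof.
move=> [_ _ MM] /setIidPl AB MB.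
by have -> : A = A * B by []; exact: MM.
Qed.

Lemma powerset_idealU M A B : ideal M -> M A -> M B ->
  M ((A : set X) `|` B : powerset_ring X).
Proof.
move=> idM MA MB; have [_ MD _] := idM.
have -> : (A : set X) `|` B = A + ((B : set X) `\` A : powerset_ring X).
  apply/seteqP; split=> x /=; rewrite /GRing.add /= /setY /=.
    have [Ax _|nAx [//|Bx]] := pselect (A x); first by left; split=> // -[].
    by right; split=> //; case.
  by move=> [[]|[[]]]; [left | right].
apply: MD => //; apply: powerset_ideal_sub MB => //; exact: subDsetl.
Qed.

(** A subset and its complement have product [0]. *)
Lemma powerset_prime_setC M A : prime_ideal M -> ~ M A ->
  M (~` (A : set X) : powerset_ring X).
Proof.
move=> [[M0 _ _] _ primeM] nMA.
have [] // := primeM A (~` (A : set X) : powerset_ring X).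
by have -> : A * (~` (A : set X) : powerset_ring X) = 0 by exact: setICr.
Qed.

End PowersetIdeals.

(** * Indicators in a product of rings *)

Section Indicators.
Variables (X : Type) (R : X -> comPzRingType).
Implicit Types (A B : powerset_ring X) (N : set (prod_ring R)).

Definition indic A : prod_ring R := fun x => `[< A x >]%:R.

Lemma indic1 : indic 1 = 1.
Proof.
by apply/functional_extensionality_dep => x; rewrite /indic asboolT.
Qed.

Lemma indic0 : indic 0 = 0.
Proof.
by apply/functional_extensionality_dep => x; rewrite /indic asboolF.
Qed.

Lemma indicM A B : indic (A * B) = indic A * indic B.
Proof.
apply/functional_extensionality_dep => x.
by rewrite {1}/indic asbool_and -mulnb natrM.
Qed.

Lemma indicC A : indic (~` (A : set X)) = 1 - indic A.
Proof.
apply/functional_extensionality_dep => x.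
have -> : (1 - indic A) x = 1 - indic A x by [].
by rewrite /indic asbool_neg; case: `[< A x >]; rewrite /= ?subrr ?subr0.
Qed.

(** Addition of subsets is a symmetric difference, so it becomes a sum of
    indicators only up to a correction on the intersection. *)
Lemma indicD A B :
  indic (A + B) = indic A + indic B - (1 + 1) * (indic A * indic B).
Proof.
apply/functional_extensionality_dep => x; rewrite -indicM.
have -> : (indic A + indic B - (1 + 1) * indic (A * B)) x =
  indic A x + indic B x - (1 + 1) * indic (A * B) x by [].
rewrite /indic; have -> : `[< (A + B)%R x >] = `[< A x >] (+) `[< B x >].
  apply/asboolP/idP; rewrite /GRing.add /= /setY /=.
    by case: asboolP => Ax; case: asboolP => Bx //=; tauto.
  by case: asboolP => Ax; case: asboolP => Bx //= _; tauto.
have -> : `[< (A * B)%R x >] = `[< A x >] && `[< B x >] by exact: asbool_and.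
by case: `[< A x >]; case: `[< B x >] => /=; ring.
Qed.

Definition indic_ideal N : set (powerset_ring X) := [set A | N (indic A)].

Lemma indic_ideal_prime N : prime_ideal N -> prime_ideal (indic_ideal N).
Proof.
move=> [idN properN primeN]; have [N0 ND NM] := idN.
have idI : ideal (indic_ideal N).
  split; rewrite /indic_ideal /=; first by rewrite indic0.
  - move=> A B NA NB; rewrite indicD mulrA -mulNr.
    by apply: (ND); [exact: ND | exact: NM].
  - by move=> A B NB; rewrite indicM; exact: NM.
split=> //.
  by apply/ideal_proper => //; rewrite /indic_ideal /= indic1; apply/ideal_proper.
by move=> A B; rewrite /indic_ideal /= indicM; exact: primeN.
Qed.

Definition indic_Spec (N : Spec (prod_ring R)) : Spec (powerset_ring X) :=
  MkSpec (indic_ideal_prime (Spec_prime N)).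

End Indicators.

Arguments indic {X} R A _.

(** * Products of local rings *)

Section FlatIdeals.
Variables (X : Type) (R : X -> comPzRingType) (m : forall x, set (R x)).
Hypothesis R_local : forall x, local_ring (R x).
Hypothesis m_maximal : forall x, maximal_ideal (@m x).
Implicit Types (A : powerset_ring X) (f g : prod_ring R).
Implicit Types (M : set (powerset_ring X)) (N : set (prod_ring R)).

Lemma Omega_indic A : Omega m (indic R A) = A.
Proof.
apply/seteqP; split=> x; rewrite /Omega /indic /=;
  have /maximal_idealP[[m0 _ _] m1 _] := m_maximal x;
  by case: asboolP.
Qed.

Lemma Omega0 : Omega m 0 = 0.
Proof. by rewrite -(indic0 R) Omega_indic. Qed.

Lemma Omega1 : Omega m 1 = 1.
Proof. by rewrite -(indic1 R) Omega_indic. Qed.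

Lemma OmegaD_sub f g : (Omega m (f + g) : set X) `<=` Omega m f `|` Omega m g.
Proof.
move=> x /= nmfg; have [[_ mD _] _ _] := m_maximal x.
have [mf|] := pselect (m (f x)); last by left.
by right=> mg; apply: nmfg; exact: mD.
Qed.

Lemma OmegaM_sub f g : (Omega m (f * g) : set X) `<=` Omega m g.
Proof.
move=> x /= nmfg mg; have [[_ _ mM] _ _] := m_maximal x.
by apply: nmfg; exact: mM.
Qed.

(** The inverses of the [f x] for [x] in [Omega m f], extended by [0], form
    the cofactor [g]. *)
Lemma indic_Omega_multiple f : exists g, g * f = indic R (Omega m f).
Proof.
have inv x : exists r : R x, r * f x = indic R (Omega m f) x.
  rewrite /indic; case: asboolP => [nmf|_].
    exact: (local_unit (R_local x) (m_maximal x) nmf).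
  by exists 0; rewrite mul0r.
exists (fun x => projT1 (cid (inv x))).
by apply/functional_extensionality_dep => x; exact: (projT2 (cid (inv x))).
Qed.

Lemma flat_ideal M : ideal M -> ideal (flat m M).
Proof.
move=> idM; split; rewrite /flat /=.
- by rewrite Omega0; case: idM.
- move=> f g Mf Mg; apply: (powerset_ideal_sub idM (@OmegaD_sub f g)).
  exact: powerset_idealU.
- by move=> r f; apply: powerset_ideal_sub => //; exact: OmegaM_sub.
Qed.

Lemma flat_not1 M : prime_ideal M -> ~ flat m M 1.
Proof.
by move=> [idM properM _]; rewrite /flat /= Omega1; exact/ideal_proper.
Qed.

Lemma flat_maximal M : prime_ideal M -> maximal_ideal (flat m M).
Proof.
move=> primeM; have [idM _ _] := primeM.
apply/maximal_idealP; split.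
- exact: flat_ideal idM.
- exact: flat_not1 primeM.
- move=> f nMf; have [g gf] := indic_Omega_multiple f; exists g.
  by rewrite gf -indicC /flat /= Omega_indic; exact: powerset_prime_setC.
Qed.

Lemma flatK M : indic_ideal (flat m M) = M.
Proof.
by apply/seteqP; split=> A; rewrite /indic_ideal /flat /= Omega_indic.
Qed.

Lemma indic_idealK N : maximal_ideal N -> flat m (indic_ideal N) = N.
Proof.
move=> maxN; have primeI := indic_ideal_prime (maximal_prime maxN).
have [idI _ _] := primeI; apply: maximal_ideal_eq => //.
- exact: flat_ideal.
- exact: flat_not1.
- move=> f Nf; rewrite /flat /indic_ideal /=.
  have [g <-] := indic_Omega_multiple f.
  by have [[_ _ NM] _ _] := maxN; exact: NM.
Qed.

Definition flat_Spec (M : Spec (powerset_ring X)) : Spec (prod_ring R) :=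
  MkSpec (maximal_prime (flat_maximal (Spec_prime M))).

Lemma flat_Spec_Max (M : Spec (powerset_ring X)) :
  flat_Spec M \in Max (prod_ring R).
Proof. by rewrite inE; exact: flat_maximal (Spec_prime M). Qed.

Definition flat_Max (M : Spec (powerset_ring X)) : Max (prod_ring R) :=
  SigSub (flat_Spec_Max M).

Lemma flat_Max_homeomorphism : homeomorphism flat_Max.
Proof.
exists (fun N : Max (prod_ring R) => indic_Spec (val N)); split.
- by move=> M; apply: Spec_inj; exact: flatK.
- move=> N; apply: val_inj; apply: Spec_inj; apply: indic_idealK.
  by have := valP N; rewrite inE.
- (* The topology on [Max] is induced by the inclusion into [Spec]. *)
  apply/continuous_comp_initial.
  exact: (@continuous_preimage _ _ (Omega m) flat_Spec).
- move=> N; apply: continuous_comp; first exact: initial_continuous.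
  exact: (@continuous_preimage _ _ (indic R) (@indic_Spec X R)).
Qed.

End FlatIdeals.

Theorem theorem6p3 (X : Type) (R : X -> comPzRingType)
    (m : forall x : X, set (R x))
    (R_local : forall x : X, local_ring (R x))
    (m_maximal : forall x : X, maximal_ideal (m x)) :
  exists psi : Spec (powerset_ring X) -> Max (prod_ring R),
    (forall M : Spec (powerset_ring X),
       Spec_set (val (psi M)) = flat m (Spec_set M)) /\
    homeomorphism psi.
Proof.
exists (flat_Max R_local m_maximal); split=> //.
exact: flat_Max_homeomorphism.
Qed.
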